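(* Let $(R,\mathfrak m,k)$ be a Noetherian (standard graded) local ring, and write its associated graded ring as $\operatorname{gr}_{\mathfrak m}(R)\cong S/I$, where $S=k[x_1,\dots,x_{\mu(\mathfrak m)}]$ is a polynomial ring over the residue field $k$ (standard graded) and $I$ is a homogeneous ideal of $S$. Let $I_2$ be the ideal of $S$ generated by the homogeneous elements of $I$ of degree two. Then $\operatorname{cs}(S/I)=\operatorname{cs}(S/I_2)$ and $\operatorname{ms}(S/I)=\operatorname{ms}(S/I_2)$.
   Context: Rings are commutative with unity. A ''Noetherian (standard graded) local ring $(R,\mathfrak m)$'' means either a Noetherian local ring with maximal ideal $\mathfrak m$, or a Noetherian standard graded ring $R=\bigoplus_{i\ge 0}R_i$ with $R_0$ a field, $R=R_0[R_1]$ and $\mathfrak m=\bigoplus_{i\ge1}R_i$. $\operatorname{gr}_{\mathfrak m}(R)=\bigoplus_{i\ge0}\mathfrak m^i/\mathfrak m^{i+1}$, and $\mu(I)=\dim_k(I/\mathfrak mI)$. For a standard graded $k$-algebra $A=\bigoplus_{i\ge 0}A_i$ with $A_0=k$ and homogeneous maximal ideal $\mathfrak n=\bigoplus_{i\ge1}A_i$, putting $\mu(J)=\dim_k(J/\mathfrak nJ)$ for homogeneous ideals $J$, $$\operatorname{cs}(A)=\min\{\mu(J): J\subseteq\mathfrak n \text{ a homogeneous ideal with } J^2=\mathfrak n^2\},\qquad \operatorname{ms}(A)=\min\{\mu(J): J\subseteq \mathfrak n \text{ a homogeneous ideal with } J\supseteq \mathfrak n^2\}.$$ *)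

(* Defs.v *)
From HB Require Import structures.
From mathcomp Require Import all_boot all_order all_algebra.
From mathcomp Require Import boolp classical_sets.
From mathcomp Require Import mpoly.

Set Implicit Arguments.
Unset Strict Implicit.
Unset Printing Implicit Defensive.

Import GRing.Theory.

Local Open Scope ring_scope.
Local Open Scope quotient_scope.
Local Open Scope classical_set_scope.

(* Ideals are sets [J : set A]; an ideal by which one takes a quotient is an
   [idealr A] (bundled proper ideal), seen as a set by [set` I]. *)

Section Ideals.
Variable A : comNzRingType.
Implicit Types (J K M X : set A).

Definition is_ideal J : Prop :=
  [/\ J 0, (forall x y, J x -> J y -> J (x + y)) & forall a x, J x -> J (a * x)].

Definition ideal_span X : set A := smallest is_ideal X.

Definition idealM J K : set A :=
  ideal_span [set z | exists x y, [/\ J x, K y & z = x * y]].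

Fixpoint ideal_pow J (i : nat) : set A :=
  if i is i'.+1 then idealM J (ideal_pow J i') else setT.

Definition noetherian : Prop :=
  forall J, is_ideal J -> exists s : seq A, J = ideal_span [set` s].

Definition is_maximal M : Prop :=
  [/\ is_ideal M, M <> setT &
    forall J, is_ideal J -> M `<=` J -> J = M \/ J = setT].

Definition is_local M : Prop :=
  is_maximal M /\ forall M', is_maximal M' -> M' = M.

(* [is_mu n J d] : J/nJ has dimension d over the field A/n.  The classes of
   the b_i form a basis of J/nJ; scalars of A/n are given by representatives
   c_i in A, and such a scalar is zero when c_i lies in n. *)
Definition is_mu (n : set A) J (d : nat) : Prop :=
  exists b : 'I_d -> A,
    [/\ forall i, J (b i),
        forall x, J x -> exists c : 'I_d -> A,
          idealM n J (x - \sum_(i < d) c i * b i)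
      & forall c : 'I_d -> A,
          idealM n J (\sum_(i < d) c i * b i) -> forall i, n (c i)].

Lemma is_ideal_span X : is_ideal (ideal_span X).
Proof.
split=> [J [[J0 _ _] _] //|x y Hx Hy J HJ|a x Hx J HJ].
- by case: (HJ) => -[_ JD _] _; apply: JD; [apply: Hx|apply: Hy].
- by case: (HJ) => -[_ _ JM] _; exact: JM (Hx _ HJ).
Qed.

Lemma sub_ideal_span X : X `<=` ideal_span X.
Proof. by move=> x Xx J [_]; apply. Qed.

Lemma ideal_span_sub X J : is_ideal J -> X `<=` J -> ideal_span X `<=` J.
Proof. by move=> HJ XJ x; apply. Qed.

Lemma is_idealN J x : is_ideal J -> J x -> J (- x).
Proof. by case=> _ _ JM Jx; rewrite -mulN1r; apply: JM. Qed.

Lemma is_ideal_sum J (I : Type) (s : seq I) (P : pred I) (F : I -> A) :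
  is_ideal J -> (forall i, J (F i)) -> J (\sum_(i <- s | P i) F i).
Proof. by case=> J0 JD _ JF; elim/big_ind: _ => // x y; apply: JD. Qed.

Lemma is_ideal_pow J i : is_ideal (ideal_pow J i).
Proof. by case: i => [|i] /=; [split|apply: is_ideal_span]. Qed.

Lemma ideal_powD J i j x y :
  ideal_pow J i x -> ideal_pow J j y -> ideal_pow J (i + j) (x * y).
Proof.
elim: i x => [|i IH] x /= Hx Hy.
  by case: (is_ideal_pow J j) => _ _; apply.
suff: idealM J (ideal_pow J i) `<=`
    [set z | idealM J (ideal_pow J (i + j)) (z * y)] by apply.
apply: ideal_span_sub.
  have [S0 SD SM] := is_ideal_pow J (i + j).+1.
  split=> /= [|u v Hu Hv|a u Hu]; rewrite /= ?mul0r ?mulrDl -?mulrA //.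
  - exact: SD.
  - exact: SM.
move=> _ [u [v [Ju Hv ->]]] /=; apply: sub_ideal_span.
by exists u, (v * y); split=> //; [apply: IH|rewrite mulrA].
Qed.

End Ideals.

Arguments noetherian A : clear implicits.

Section Graded.
Variables (A : comNzRingType) (G : nat -> set A).

Definition is_grading : Prop :=
  [/\ forall i, G i 0 /\ (forall x y, G i x -> G i y -> G i (x - y)),
      G 0 1 /\ (forall i j x y, G i x -> G j y -> G (i + j)%N (x * y)),
      forall x, exists N (a : nat -> A),
        (forall i, G i (a i)) /\ x = \sum_(i < N) a i
    & forall N (a : nat -> A), (forall i, G i (a i)) ->
        \sum_(i < N) a i = 0 -> forall i, (i < N)%N -> a i = 0].

Definition is_subring (B : set A) : Prop :=
  [/\ B 1, (forall x y, B x -> B y -> B (x - y))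
    & forall x y, B x -> B y -> B (x * y)].

Definition standard_graded : Prop :=
  [/\ is_grading,
      forall x, G 0 x -> x <> 0 -> exists2 y, G 0 y & x * y = 1
    & smallest is_subring (G 0 `|` G 1) = setT].

Definition irrelevant_ideal : set A :=
  [set x | exists N (a : nat -> A),
     (forall i, G i.+1 (a i)) /\ x = \sum_(i < N) a i].

Definition homogeneous_ideal (J : set A) : Prop :=
  is_ideal J /\ forall x, J x -> exists N (a : nat -> A),
    (forall i, G i (a i) /\ J (a i)) /\ x = \sum_(i < N) a i.

Local Notation n := irrelevant_ideal.

Definition cs_ideal (J : set A) : Prop :=
  [/\ homogeneous_ideal J, J `<=` n & ideal_pow J 2 = ideal_pow n 2].

Definition ms_ideal (J : set A) : Prop :=
  [/\ homogeneous_ideal J, J `<=` n & ideal_pow n 2 `<=` J].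

(* c = min {mu(J) : P J}; an ideal J with J/nJ of infinite dimension does not
   take part in the minimum. *)
Definition is_min_mu (P : set A -> Prop) (c : nat) : Prop :=
  (exists2 J, P J & is_mu n J c) /\
  forall J d, P J -> is_mu n J d -> (c <= d)%N.

Definition is_cs (c : nat) : Prop := is_min_mu cs_ideal c.
Definition is_ms (c : nat) : Prop := is_min_mu ms_ideal c.

End Graded.

Definition noetherian_local_or_graded (R : comNzRingType) (m : set R) : Prop :=
  noetherian R /\
  (is_local m \/ exists2 G, standard_graded G & m = irrelevant_ideal G).

(* Isomorphism of graded k-algebras; iA and iB are the structure maps. *)
Definition graded_iso (k A B : comNzRingType) (iA : k -> A) (iB : k -> B)
    (GA : nat -> set A) (GB : nat -> set B) : Prop :=
  exists f : {rmorphism A -> B},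
    [/\ bijective f, forall c, f (iA c) = iB c
      & forall i, f @` GA i = GB i].

(* The associated graded ring: \bigoplus_i m^i is the ring of polynomials over
   R whose i-th coefficient lies in m^i (the Rees algebra), and gr_m(R) is its
   quotient by the ideal \bigoplus_i m^(i+1). *)
Section AssociatedGraded.
Variables (R : comNzRingType) (m : idealr R).

Local Notation mpow := (ideal_pow [set` m]).

Definition rees_pred : {pred {poly R}} := fun p => `[< forall i, mpow i p`_i >].

Lemma rees_predP (p : {poly R}) : reflect (forall i, mpow i p`_i) (p \in rees_pred).
Proof. exact: asboolP. Qed.

Lemma rees_subring : subring_closed rees_pred.
Proof.
split.
- apply/rees_predP=> i; rewrite coef1; case: i => [|i] //=.
  by case: (is_ideal_pow [set` m] i.+1).
- move=> p q /rees_predP Hp /rees_predP Hq; apply/rees_predP=> i.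
  rewrite coefB; have Hi := is_ideal_pow [set` m] i.
  by case: (Hi) => _ HD _; apply: HD => //; apply: is_idealN.
- move=> p q /rees_predP Hp /rees_predP Hq; apply/rees_predP=> i.
  rewrite coefM; apply: is_ideal_sum; first exact: is_ideal_pow.
  move=> j; have := ideal_powD (Hp j) (Hq (i - j)%N).
  by rewrite subnKC // -ltnS.
Qed.

HB.instance Definition _ :=
  GRing.isSubringClosed.Build {poly R} rees_pred rees_subring.

Record rees := Rees { rees_val : {poly R}; reesP : rees_val \in rees_pred }.

HB.instance Definition _ := [isSub for rees_val].
HB.instance Definition _ := [Choice of rees by <:].
HB.instance Definition _ := [SubChoice_isSubComNzRing of rees by <:].

Definition rees_ideal : {pred rees} :=
  fun p => `[< forall i, mpow i.+1 (val p)`_i >].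

Lemma rees_ideal_closed : idealr_closed rees_ideal.
Proof.
split.
- apply/asboolP=> i; rewrite raddf0 coef0.
  by case: (is_ideal_pow [set` m] i.+1).
- apply/negP=> /asboolP/(_ 0); rewrite rmorph1 coef1 /= => H1.
  have : [set` m] (1 : R).
    apply: (ideal_span_sub _ _ H1).
      split=> [|x y|a x]; rewrite /= ?rpred0 //.
      - exact: rpredD.
      - exact: idealMr.
    by move=> _ [x [y [mx _ ->]]]; rewrite /= mulrC idealMr.
  by rewrite /= idealr1.
- move=> a p q /asboolP Hp /asboolP Hq; apply/asboolP=> i.
  have -> : val (a * p + q) = val a * val p + val q :> {poly R} by [].
  rewrite coefD.
  have Hi := is_ideal_pow [set` m] i.+1; case: (Hi) => _ HD _; apply: HD => //.
  rewrite coefM; apply: (@is_ideal_sum _ (mpow i.+1)) => // j.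
  have /rees_predP Ha := reesP a.
  have := ideal_powD (Ha j) (Hp (i - j)%N).
  by rewrite addnS subnKC // -ltnS.
Qed.

HB.instance Definition _ := isIdealr.Build rees rees_ideal rees_ideal_closed.

Definition assoc_gr : comNzRingType := {ideal_quot rees_ideal}.

Definition assoc_gr_grading (i : nat) : set assoc_gr :=
  [set x | exists2 p : rees,
     (forall j, j <> i -> (val p)`_j = 0) & x = \pi_{ideal_quot rees_ideal} p].

Lemma rees_const_subproof (r : R) : r%:P \in rees_pred.
Proof.
apply/rees_predP=> -[|i]; rewrite coefC //=.
by case: (is_ideal_pow [set` m] i.+1).
Qed.

(* The structure map from k = R/m, onto the degree 0 part of gr_m(R). *)
Definition assoc_gr_const (c : {ideal_quot m}) : assoc_gr :=
  \pi_{ideal_quot rees_ideal} (Rees (rees_const_subproof (repr c))).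

End AssociatedGraded.

Arguments assoc_gr_grading {R} m i.
Arguments assoc_gr_const {R} m c.

Section PolynomialQuotient.
Variables (k : comNzRingType) (n : nat).
Local Notation S := {mpoly k[n]}.

Definition mpoly_grading (i : nat) : set S := [set p | p \is i.-homog].

Variable I : idealr S.

Definition mpoly_quot_grading (i : nat) : set {ideal_quot I} :=
  \pi_{ideal_quot I} @` mpoly_grading i.

Definition mpoly_quot_const (c : k) : {ideal_quot I} := \pi_{ideal_quot I} c%:MP.

Definition quadratic_part : {pred S} :=
  fun p => `[< ideal_span [set q | q \in I /\ mpoly_grading 2 q] p >].

Lemma quadratic_part_closed : idealr_closed quadratic_part.
Proof.
have [H0 HD HM] := is_ideal_span [set q | q \in I /\ mpoly_grading 2 q].
split; first exact/asboolP.
- apply/negP=> /asboolP H1.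
  suff : [set` I] (1 : S) by rewrite /= idealr1.
  apply: (ideal_span_sub _ _ H1); last by move=> q [].
  split=> [|x y|a x]; rewrite /= ?rpred0 //.
  - exact: rpredD.
  - exact: idealMr.
- move=> a p q /asboolP Hp /asboolP Hq; apply/asboolP.
  by apply: HD => //; apply: HM.
Qed.

HB.instance Definition _ := isIdealr.Build S quadratic_part quadratic_part_closed.

End PolynomialQuotient.

Arguments mpoly_grading k n i : clear implicits.
Arguments mpoly_quot_grading {k n} I i.
Arguments mpoly_quot_const {k n} I c.
Arguments quadratic_part {k n} I.

(* Main.v *)
Require Import Defs.
From HB Require Import structures.
From mathcomp Require Import all_boot all_order all_algebra.
From mathcomp Require Import boolp classical_sets.
From mathcomp Require Import mpoly.

Set Implicit Arguments.
Unset Strict Implicit.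
Unset Printing Implicit Defensive.

Import GRing.Theory.

Local Open Scope ring_scope.
Local Open Scope quotient_scope.
Local Open Scope classical_set_scope.

(* Since mu(m) is the number of variables, the presentation gr_m(R) = S/I has no
   relations of degree 0 or 1.  So, N being the ideal of S generated by the
   variables, I and I_2 are homogeneous ideals contained in N^2 with the same
   quadratic forms, hence they agree modulo N^3.  The ideals that compete in cs
   or ms pull back to homogeneous ideals K of S such that N^3 is contained in
   NK + I.  Transporting such a K from S/I to S/I_2, or back, preserves mu
   because NK + I = NK + I_2.  It also preserves the condition on K; for cs this
   is because K^2 = N^2 modulo I or I_2 can be tested in degree two. *)

(** * Products and powers of ideals *)

Section Ideals.
Variable A : comNzRingType.
Implicit Types J K X : set A.

Lemma is_idealM J K : is_ideal (idealM J K).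
Proof. exact: is_ideal_span. Qed.

Lemma mem_idealM J K x y : J x -> K y -> idealM J K (x * y).
Proof. by move=> Jx Ky; apply: sub_ideal_span; exists x, y. Qed.

Lemma idealM_sub J K L : is_ideal L ->
  (forall x y, J x -> K y -> L (x * y)) -> idealM J K `<=` L.
Proof.
move=> HL JKL; apply: ideal_span_sub => // _ [x [y [Jx Ky ->]]].
exact: JKL.
Qed.

Lemma idealMS J J' K K' :
  J `<=` J' -> K `<=` K' -> idealM J K `<=` idealM J' K'.
Proof.
move=> JJ KK; apply: idealM_sub; first exact: is_idealM.
by move=> x y /JJ Jx /KK; apply: mem_idealM.
Qed.

Lemma idealM_subr J K : is_ideal K -> idealM J K `<=` K.
Proof. by move=> HK; apply: idealM_sub => // x y _; case: HK => _ _; apply. Qed.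

Lemma ideal_pow1 J : is_ideal J -> ideal_pow J 1 = J.
Proof.
move=> HJ; apply/seteqP; split=> [|x Jx].
  by apply: idealM_sub => // x y Jx _; rewrite mulrC; case: HJ => _ _; apply.
by rewrite -[x]mulr1; apply: mem_idealM.
Qed.

Lemma ideal_pow2 J : is_ideal J -> ideal_pow J 2 = idealM J J.
Proof. by move=> HJ; rewrite -[LHS]/(idealM J (ideal_pow J 1)) ideal_pow1. Qed.

Lemma ideal_powS J K i : J `<=` K -> ideal_pow J i `<=` ideal_pow K i.
Proof. by move=> JK; elim: i => //= i IH; apply: idealMS. Qed.

Lemma is_idealB J x y : is_ideal J -> J x -> J y -> J (x - y).
Proof.
by move=> HJ Jx Jy; case: (HJ) => _ + _; apply => //; apply: is_idealN.
Qed.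

Lemma is_idealBr J x y : is_ideal J -> J (x - y) -> J y -> J x.
Proof. by case=> _ JD _ Jxy Jy; rewrite -(subrK y x); apply: JD. Qed.

End Ideals.

(** * Images and preimages of ideals under a surjective ring homomorphism *)

Section Image.
Variables (S Q : comNzRingType) (f : {rmorphism S -> Q}).
Hypothesis f_surj : forall y, exists x, f x = y.
Implicit Types K X Y : set S.

Lemma is_ideal_preimage (J : set Q) : is_ideal J -> is_ideal (f @^-1` J).
Proof.
case=> J0 JD JM; split=> [|x y|a x] /=.
- by rewrite rmorph0.
- by rewrite rmorphD; apply: JD.
- by rewrite rmorphM; apply: JM.
Qed.

Lemma is_ideal_image K : is_ideal K -> is_ideal (f @` K).
Proof.
case=> K0 KD KM; split=> [|_ _ [x Kx <-] [y Ky <-]|b _ [x Kx <-]].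
- by exists 0; rewrite ?rmorph0.
- by exists (x + y); rewrite ?rmorphD //; apply: KD.
- by have [a <-] := f_surj b; exists (a * x); rewrite ?rmorphM //; apply: KM.
Qed.

(** One inclusion holds because preimages of ideals are ideals, the other because surjectivity of
    [f] makes images of ideals ideals. *)
Lemma image_ideal_span X : f @` ideal_span X = ideal_span (f @` X).
Proof.
apply/seteqP; split.
  move=> _ [x Xx <-].
  apply: (@ideal_span_sub _ X (f @^-1` ideal_span (f @` X))) => //.
    exact/is_ideal_preimage/is_ideal_span.
  by move=> y Xy; apply: sub_ideal_span; exists y.
apply: ideal_span_sub; first exact/is_ideal_image/is_ideal_span.
by move=> _ [x Xx <-]; exists x => //; apply: sub_ideal_span.
Qed.

Lemma image_idealM X Y : f @` idealM X Y = idealM (f @` X) (f @` Y).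
Proof.
rewrite image_ideal_span; congr ideal_span; apply/seteqP; split.
  move=> _ [_ [x [y [Xx Yy ->]]] <-].
  by exists (f x), (f y); rewrite rmorphM; split.
move=> _ [_ [_ [[x Xx <-] [y Yy <-] ->]]].
by exists (x * y); [exists x, y|rewrite rmorphM].
Qed.

Lemma image_setT_surj : f @` setT = setT.
Proof. by apply/seteqP; split=> // y _; have [x <-] := f_surj y; exists x. Qed.

Lemma image_ideal_pow X i : f @` ideal_pow X i = ideal_pow (f @` X) i.
Proof.
by elim: i => [|i IH] /=; rewrite ?image_setT_surj // image_idealM IH.
Qed.

Lemma image_preimage_surj (J : set Q) : f @` (f @^-1` J) = J.
Proof.
apply/seteqP; split=> [_ [x Jx <-] //|y Jy].
by have [x fx] := f_surj y; exists x; rewrite /= ?fx.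
Qed.

Lemma image_irrelevant_ideal (G : nat -> set S) :
  f @` irrelevant_ideal G = irrelevant_ideal (fun i => f @` G i).
Proof.
apply/seteqP; split=> [_ [_ [N [a [Ga ->]]] <-]|_ [N [a [Ga ->]]]].
  by exists N, (f \o a); rewrite rmorph_sum; split=> // i; exists (a i).
have /choice[b Hb] i : exists b, G i.+1 b /\ f b = a i.
  by have [b] := Ga i; exists b.
exists (\sum_(i < N) b i); first by exists N, b; split=> // i; case: (Hb i).
by rewrite rmorph_sum; apply: eq_bigr => i _; case: (Hb i).
Qed.

Lemma image_ideal_ker K x : is_ideal K -> (forall y, f y = 0 -> K y) ->
  (f @` K) (f x) -> K x.
Proof.
move=> HK kerK [y Ky fyx]; apply: (is_idealBr HK) Ky; apply: kerK.
by rewrite rmorphB fyx subrr.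
Qed.

End Image.

(** * Comparing mu and its minima in two rings *)

Lemma is_mu_image (S Q1 Q2 : comNzRingType)
    (f1 : {rmorphism S -> Q1}) (f2 : {rmorphism S -> Q2})
    (f1_surj : forall y, exists x, f1 x = y)
    (f2_surj : forall y, exists x, f2 x = y) (n K : set S) (d : nat) :
  is_ideal n -> (forall x, f1 x = 0 -> n x) ->
  (forall x, (f1 @` idealM n K) (f1 x) <-> (f2 @` idealM n K) (f2 x)) ->
  is_mu (f1 @` n) (f1 @` K) d -> is_mu (f2 @` n) (f2 @` K) d.
Proof.
move=> Hn ker1 nK12 [b1 [Kb1 gen1 free1]].
have /choice[b Hb] i : exists b, K b /\ f1 b = b1 i.
  by have [b] := Kb1 i; exists b.
have f1b i : f1 (b i) = b1 i by case: (Hb i).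
rewrite -image_idealM // in gen1 free1.
exists (f2 \o b); rewrite -image_idealM //; split=> [i|_ [x Kx <-]|c2].
- by exists (b i) => //; case: (Hb i).
- have [c1 Hc1] : exists c, (f1 @` idealM n K) (f1 x - \sum_(i < d) c i * b1 i).
    by apply: gen1; exists x.
  have /choice[c Hc] i : exists c, f1 c = c1 i by exact: f1_surj.
  exists (f2 \o c).
  have f2E : f2 x - \sum_(i < d) f2 (c i) * f2 (b i) =
      f2 (x - \sum_(i < d) c i * b i).
    rewrite rmorphB rmorph_sum; congr (_ - _).
    by apply: eq_bigr => i _; rewrite rmorphM.
  rewrite /= f2E; apply/nK12; rewrite rmorphB rmorph_sum.
  by under eq_bigr do rewrite rmorphM Hc f1b.
- have /choice[c Hc] i : exists c, f2 c = c2 i by exact: f2_surj.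
  have -> : \sum_(i < d) c2 i * (f2 \o b) i = f2 (\sum_(i < d) c i * b i).
    by rewrite rmorph_sum; apply: eq_bigr => i _; rewrite rmorphM Hc.
  move/nK12; rewrite rmorph_sum; under eq_bigr do rewrite rmorphM f1b.
  move/free1 => nc i; exists (c i) => //.
  exact: image_ideal_ker (nc i).
Qed.

(** Competitors with equal mu on both sides make the sets of attained values coincide, and hence the
    minima. *)
Lemma is_min_mu_transfer (A B : comNzRingType)
    (GA : nat -> set A) (GB : nat -> set B) PA PB (c : nat) :
  (forall J, PA J -> exists2 J', PB J' & forall d,
     is_mu (irrelevant_ideal GA) J d <-> is_mu (irrelevant_ideal GB) J' d) ->
  (forall J, PB J -> exists2 J', PA J' & forall d,
     is_mu (irrelevant_ideal GB) J d <-> is_mu (irrelevant_ideal GA) J' d) ->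
  is_min_mu GA PA c -> is_min_mu GB PB c.
Proof.
move=> AB BA [[J PJ muJ] minc]; split.
  by have [J' PJ' mu] := AB J PJ; exists J' => //; apply/mu.
move=> J' d PJ' muJ'; have [J0 PJ0 mu] := BA J' PJ'.
by apply: (minc J0) => //; apply/mu.
Qed.

(** The attained values form a set of natural numbers, so a single competitor with finite mu
    guarantees a least one. *)
Lemma is_min_mu_exists (A : comNzRingType) (G : nat -> set A) P J d :
  P J -> is_mu (irrelevant_ideal G) J d -> exists c, is_min_mu G P c.
Proof.
move=> PJ muJ.
pose attained c := `[< exists2 J, P J & is_mu (irrelevant_ideal G) J c >].
have ex_attained : exists c, attained c by exists d; apply/asboolP; exists J.
case: (ex_minnP ex_attained) => c /asboolP cP cmin.
exists c; split=> // J' d' PJ' muJ'.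
by apply: cmin; apply/asboolP; exists J'.
Qed.

(** * The polynomial ring: powers of N and homogeneous ideals *)

Section Mpoly.
Variables (k : comNzRingType) (n : nat).
Local Notation S := {mpoly k[n]}.
Local Notation G := (mpoly_grading k n).
Local Notation pi d := (pihomog mdeg d).
Implicit Types (p q : S) (K : set S).

(** This is N^e, as [ideal_pow_irrelevant] shows, in a form where membership is read off
    coefficients. *)
Definition order_ge (e : nat) : set S :=
  [set p | forall m, (mdeg m < e)%N -> p@_m = 0].

Lemma pihomog_sum p : p = \sum_(d < msize p) pi d p.
Proof. exact: pihomog_partitionE. Qed.

Lemma mcoeff_pihomog p d m : (pi d p)@_m = if mdeg m == d then p@_m else 0.
Proof.
have [<-{d}|ne] := eqVneq; last exact: (dhomog_nemf_coeff (pihomogP _ d p)).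
(* The range of degrees is enlarged beyond [msize p] so that [mdeg m] is always one of the
   indices. *)
have := congr1 (mcoeff m)(pihomog_partitionE (leq_addr (mdeg m).+1 (msize p))).
have lt_m : (mdeg m < msize p + (mdeg m).+1)%N by rewrite addnS ltnS leq_addl.
rewrite raddf_sum (bigD1 (Ordinal lt_m)) //= big1 ?addr0 => [//|i ne].
apply: (dhomog_nemf_coeff (pihomogP _ i p)).
by apply: contraNneq ne => eq_i; apply/eqP/val_inj.
Qed.

Lemma mcoeffM_eq0 p q m :
  (forall m1 m2, m = (m1 + m2)%MM -> p@_m1 * q@_m2 = 0) -> (p * q)@_m = 0.
Proof. by move=> pq0; rewrite mcoeffM big1 // => -[/= m1 m2] /eqP/pq0. Qed.

Lemma order_geM d e p q :
  order_ge d p -> order_ge e q -> order_ge (d + e) (p * q).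
Proof.
move=> Hp Hq m lt_m; apply: mcoeffM_eq0 => m1 m2 def_m.
have [lt1|le1] := ltnP (mdeg m1) d; first by rewrite Hp ?mul0r.
rewrite Hq ?mulr0 // -(ltn_add2l d); apply: leq_ltn_trans lt_m.
by rewrite def_m mdegD leq_add2r.
Qed.

Lemma is_ideal_order_ge e : is_ideal (order_ge e).
Proof.
split=> [m _|p q Hp Hq m lt_m|p q Hq].
- exact: mcoeff0.
- by rewrite mcoeffD Hp ?Hq ?addr0.
- by rewrite -[e]add0n; apply: order_geM.
Qed.

Lemma order_ge_homog d e p : p \is d.-homog -> (e <= d)%N -> order_ge e p.
Proof.
move=> hom_p le_ed m lt_m; apply: (dhomog_nemf_coeff hom_p).
by rewrite neq_ltn (leq_trans lt_m).
Qed.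

Lemma order_geS d e : (d <= e)%N -> order_ge e `<=` order_ge d.
Proof. by move=> le_de p Hp m lt_m; apply: Hp; apply: leq_trans le_de. Qed.

Lemma order_ge_subl e p : order_ge e p -> order_ge e.+1 (p - pi e p).
Proof.
move=> Hp m; rewrite ltnS leq_eqVlt mcoeffB mcoeff_pihomog.
by case: eqP => [|_ /Hp ->]; rewrite ?subrr ?subr0.
Qed.

Lemma irrelevant_mpolyE : irrelevant_ideal G = order_ge 1.
Proof.
apply/seteqP; split=> [_ [N [a [Ga ->]]]|p p0].
  apply: (@is_ideal_sum _ (order_ge 1)) => [|i]; first exact: is_ideal_order_ge.
  by apply: order_ge_homog (Ga i) _.
exists (msize p), (fun i => pi i.+1 p); split=> [i|]; first exact: pihomogP.
have := pihomog_partitionE (leqnSn (msize p)); rewrite big_ord_recl => {1}->.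
suff -> : pi 0 p = 0 by rewrite add0r.
apply/mpolyP=> m; rewrite mcoeff_pihomog mcoeff0.
by case: eqP => // m0; rewrite p0 ?m0.
Qed.

Lemma order_ge_monomials K e p :
  is_ideal K -> (forall m, (e <= mdeg m)%N -> K 'X_[m]) -> order_ge e p -> K p.
Proof.
move=> HK KX Hp; rewrite [p]mpolyE; apply: is_ideal_sum => // m.
have [lt_m|le_m] := ltnP (mdeg m) e.
  by rewrite Hp // scale0r; case: HK.
by rewrite -mul_mpolyC; case: HK => _ _; apply; apply: KX.
Qed.

(** Subtraction of exponents is truncated, so [i] is chosen as a variable that occurs in the
    monomial. *)
Lemma monomial_split m :
  (0 < mdeg m)%N -> exists i : 'I_n, m = (U_(i) + (m - U_(i)))%MM.
Proof.
rewrite lt0n mdeg_eq0 => nz_m.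
have [i nz_mi] : exists i, m i != 0%N.
  apply/existsP; apply: contra_neqT nz_m => /existsPn m0; apply/mnmP => i.
  by rewrite mnm0E; apply/eqP; have := m0 i; rewrite negbK.
by exists i; rewrite addmC submK // lep1mP.
Qed.

(** Orders add up under products, which gives one inclusion. For the other, a monomial of degree at
    least e + 1 is a variable times a monomial of degree at least e, and induction applies. *)
Lemma ideal_pow_irrelevant e : ideal_pow (irrelevant_ideal G) e = order_ge e.
Proof.
rewrite irrelevant_mpolyE; apply/seteqP; split; elim: e => [|e IH] //=.
  apply: idealM_sub => [|p q Hp /IH Hq]; first exact: is_ideal_order_ge.
  exact: order_geM Hp Hq.
move=> p; apply: order_ge_monomials => [|m]; first exact: is_idealM.
case: (posnP (mdeg m)) => [->//|/monomial_split[i ->]].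
rewrite mdegD mdeg1 add1n ltnS mpolyXD => le_em.
apply: mem_idealM.
  by apply: (@order_ge_homog 1); rewrite ?dhomogX //= mdeg1.
by apply: IH; apply: order_ge_homog le_em; rewrite dhomogX /=.
Qed.

Lemma is_ideal_irrelevant_mpoly : is_ideal (irrelevant_ideal G).
Proof. by rewrite irrelevant_mpolyE; apply: is_ideal_order_ge. Qed.

(** The projection [pihomog mdeg d] picks the degree d term out of any decomposition into
    homogeneous elements, so the decomposition required in K must be the canonical one. *)
Lemma homogeneous_mpolyP K : homogeneous_ideal G K <->
  is_ideal K /\ forall p d, K p -> K (pi d p).
Proof.
split=> -[HK homK]; split=> //.
  move=> p d /homK[N [a [Ga ->]]]; rewrite raddf_sum /=.
  apply: is_ideal_sum => // i; have [hom_a Ka] := Ga i.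
  have [<-|ne] := eqVneq (i : nat) d; first by rewrite pihomog_dE.
  by rewrite (pihomog_ne0 ne hom_a); case: HK.
move=> p Kp; exists (msize p), (fun d => pi d p).
split; last exact: pihomog_sum.
by move=> d; split; [apply: pihomogP|apply: homK].
Qed.

(** The polynomials all of whose components lie in the span form an ideal: in a product, expand both
    factors into components and note that the (i, j) term has degree i + j. This ideal contains
    X. *)
Lemma homogeneous_span (X : set S) :
  (forall p d, X p -> ideal_span X (pi d p)) ->
  homogeneous_ideal G (ideal_span X).
Proof.
move=> homX; apply/homogeneous_mpolyP; have HX := is_ideal_span X.
have [X0 XD XM] := HX; split=> // p d Xp.
suff: ideal_span X `<=` [set q | forall d, ideal_span X (pi d q)].
  by move/(_ p Xp); apply.
apply: ideal_span_sub => [|q Xq e]; last exact: homX.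
split=> [e|q r Hq Hr e|a q Hq e]; rewrite ?raddf0 ?raddfD //=; first exact: XD.
rewrite [a]pihomog_sum [q]pihomog_sum mulr_suml raddf_sum /=.
apply: (@is_ideal_sum _ (ideal_span X)) => // i.
rewrite mulr_sumr raddf_sum /=.
apply: (@is_ideal_sum _ (ideal_span X)) => // j.
have hom_ij := dhomogM (pihomogP mdeg i a) (pihomogP mdeg j q).
have [<-|ne] := eqVneq (i + j)%N e; first by rewrite pihomog_dE //; apply: XM.
by rewrite (pihomog_ne0 ne hom_ij).
Qed.

Lemma homogeneous_idealM J K : homogeneous_ideal G J -> homogeneous_ideal G K ->
  homogeneous_ideal G (idealM J K).
Proof.
move=> /homogeneous_mpolyP[_ homJ] /homogeneous_mpolyP[_ homK].
apply: homogeneous_span => _ d [x [y [Jx Ky ->]]].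
rewrite [x]pihomog_sum [y]pihomog_sum mulr_suml raddf_sum /=.
have HJK := is_idealM J K; apply: (@is_ideal_sum _ (idealM J K)) => // i.
rewrite mulr_sumr raddf_sum /=; apply: (@is_ideal_sum _ (idealM J K)) => // j.
have hom_ij := dhomogM (pihomogP mdeg i x) (pihomogP mdeg j y).
have [<-|ne] := eqVneq (i + j)%N d.
  by rewrite pihomog_dE //; apply: mem_idealM; [apply: homJ|apply: homK].
by rewrite (pihomog_ne0 ne hom_ij); case: HJK.
Qed.

Lemma homog1E p :
  p \is 1.-homog -> p = \sum_(i < n) (p@_U_(i))%:MP * 'X_i.
Proof.
move=> hom_p; apply/mpolyP => e; rewrite raddf_sum /=.
under eq_bigr do rewrite mcoeffCM mcoeffX.
have [/eqP/mdeg1P[i /eqP ->]|ne1] := eqVneq (mdeg e) 1%N.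
  rewrite (bigD1 i) //= eqxx mulr1 big1 ?addr0 // => j ne.
  by rewrite eq_mnm1 (negPf ne) mulr0.
rewrite (dhomog_nemf_coeff hom_p ne1) big1 // => i _.
case: eqP => [e_i|_]; last by rewrite mulr0.
by rewrite -e_i mdeg1 in ne1.
Qed.

(** The variables form a basis of N/N^2. This provides the competitor with finite mu from which the
    existence of the minima follows. *)
Lemma is_mu_irrelevant_mpoly :
  is_mu (irrelevant_ideal G) (irrelevant_ideal G) n.
Proof.
have nnE : idealM (irrelevant_ideal G) (irrelevant_ideal G) = order_ge 2.
  by rewrite -(ideal_pow2 is_ideal_irrelevant_mpoly) ideal_pow_irrelevant.
(* If the combination lies in N^2, this coefficient vanishes, so [c i] has no constant term and lies
   in N. *)
have coefU (c : 'I_n -> S) i :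
    (\sum_(j < n) c j * 'X_j)@_U_(i) = (c i)@_0.
  rewrite raddf_sum (bigD1 i) //= -[X in (_ * _)@_X]addm0 mcoeffMX.
  rewrite big1 ?addr0 // => j ne.
  apply: mcoeffM_eq0 => m1 m2 Um.
  rewrite mcoeffX; case: eqP => [Uj|]; last by rewrite mulr0.
  have := congr1 (fun m : 'X_{1..n} => m j) Um.
  by rewrite mnmDE -Uj !mnm1E eqxx eq_sym (negPf ne) addn1.
exists (fun i => 'X_i); rewrite nnE irrelevant_mpolyE; split=> [i|p p0|c c0 i].
- by apply: (@order_ge_homog 1); rewrite ?dhomogX //= mdeg1.
- exists (fun i => (p@_U_(i))%:MP) => m.
  rewrite ltnS leq_eqVlt => /orP[/mdeg1P[i /eqP ->]|lt_m].
    by rewrite mcoeffB coefU mcoeffC eqxx mulr1 subrr.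
  have := is_idealB (is_ideal_order_ge 1) p0.
  apply=> //; apply: (@is_ideal_sum _ (order_ge 1)) => [|i].
    exact: is_ideal_order_ge.
  case: (is_ideal_order_ge 1) => _ _; apply.
  by apply: (@order_ge_homog 1); rewrite ?dhomogX //= mdeg1.
- move=> m; rewrite ltnS leqn0 mdeg_eq0 => /eqP ->.
  by rewrite -coefU c0 ?mdeg1.
Qed.

End Mpoly.

(** * Transfer from one quotient of S to another, in one direction *)

Section SameQuadraticPart.
Variables (k : comNzRingType) (n : nat) (Q1 Q2 : comNzRingType).
Local Notation S := {mpoly k[n]}.
Local Notation G := (mpoly_grading k n).
Local Notation nS := (irrelevant_ideal G).
Local Notation pi d := (pihomog mdeg d).
Variables (f1 : {rmorphism S -> Q1}) (f2 : {rmorphism S -> Q2}).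
Local Notation G1 := (fun i => f1 @` G i).
Local Notation G2 := (fun i => f2 @` G i).

Hypothesis f1_surj : forall y, exists x, f1 x = y.
Hypothesis f2_surj : forall y, exists x, f2 x = y.
Hypothesis ker1_ge2 : forall p, f1 p = 0 -> order_ge 2 p.
Hypothesis ker1_homog : forall p d, f1 p = 0 -> f1 (pi d p) = 0.
Hypothesis ker12 : forall p, p \is 2.-homog -> f1 p = 0 -> f2 p = 0.
Implicit Types K : set S.

Let is_ideal_nS := is_ideal_irrelevant_mpoly k n.

(** Lift the terms of a decomposition of [f1 p] to forms [s i] of degree i. Then p differs from
    their sum by an element of the kernel, which is homogeneous, so each component of p has the same
    image as that of the sum, namely the image of some [s i] or 0. *)
Lemma homogeneous_preimage (J : set Q1) : homogeneous_ideal G1 J ->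
  homogeneous_ideal G (f1 @^-1` J).
Proof.
move=> [HJ homJ]; apply/homogeneous_mpolyP.
split=> [|p d /= /homJ[N [a [Ja fp]]]]; first exact: is_ideal_preimage.
have /choice[s Hs] i : exists s, [/\ s \is i.-homog, f1 s = a i & J (f1 s)].
  by have [[s hs <-] Js] := Ja i; exists s.
have /(ker1_homog d) : f1 (p - \sum_(i < N) s i) = 0.
  rewrite rmorphB fp rmorph_sum; apply/eqP; rewrite subr_eq0; apply/eqP.
  by apply: eq_bigr => i _; case: (Hs i).
rewrite raddfB /= rmorphB => /subr0_eq ->.
rewrite [pi d _]raddf_sum rmorph_sum /=.
apply: is_ideal_sum => // i; have [hom_s _ Js] := Hs i.
have [<-|ne] := eqVneq (i : nat) d; first by rewrite pihomog_dE.
by rewrite (pihomog_ne0 ne hom_s) rmorph0; case: HJ.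
Qed.

Lemma homogeneous_image K :
  homogeneous_ideal G K -> homogeneous_ideal G2 (f2 @` K).
Proof.
move=> [HK homK]; split=> [|_ [x Kx <-]]; first exact: is_ideal_image.
have [N [a [Ha ->]]] := homK x Kx.
exists N, (f2 \o a); rewrite rmorph_sum; split=> // i.
by have [Ga Ka] := Ha i; split; exists (a i).
Qed.

Lemma sub_preimage_nS (J : set Q1) :
  J `<=` irrelevant_ideal G1 -> f1 @^-1` J `<=` nS.
Proof.
move=> Jn x /Jn; rewrite -image_irrelevant_ideal.
apply: image_ideal_ker => // y /ker1_ge2.
by rewrite irrelevant_mpolyE; apply: order_geS.
Qed.

(** Write x = y + w with y in NK and w in the kernel of [f1]. The quadratic component of w is also
    killed by [f2], and the rest of w has order at least 3, hence lies in NK modulo the kernel of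
    [f2]. *)
Lemma mod_idealM_transfer K x :
  (forall p, order_ge 3 p -> (f2 @` idealM nS K) (f2 p)) ->
  (f1 @` idealM nS K) (f1 x) -> (f2 @` idealM nS K) (f2 x).
Proof.
move=> nK3 [y nKy f1yx].
have f1w : f1 (x - y) = 0 by rewrite rmorphB f1yx subrr.
set w := x - y in f1w.
have -> : x = y + (pi 2 w + (w - pi 2 w)) by rewrite addrC subrKC subrK.
have /ker12 f2w : pi 2 w \is 2.-homog by apply: pihomogP.
rewrite rmorphD [f2 (_ + (_ - _))]rmorphD f2w ?add0r; last exact: ker1_homog.
have [_ HD _] : is_ideal (f2 @` idealM nS K).
  by apply: is_ideal_image => //; apply: is_idealM.
by apply: HD; [exists y|apply/nK3/order_ge_subl/ker1_ge2].
Qed.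

(** Since N^2 is generated by quadratic monomials, only quadratic forms q need to be reached. If q -
    y is in the kernel of [f1] with y in K^2, its quadratic component is in both kernels, and the
    quadratic component of y stays in K^2 by homogeneity. *)
Lemma square_transfer K : homogeneous_ideal G K -> K `<=` nS ->
  f1 @` ideal_pow K 2 = f1 @` ideal_pow nS 2 ->
  f2 @` ideal_pow K 2 = f2 @` ideal_pow nS 2.
Proof.
move=> homK Kn eqK1; apply/seteqP; split.
  by apply: image_subset; apply: ideal_powS.
rewrite ideal_pow_irrelevant => _ [p p2 <-].
have [HK _] := homK.
have /homogeneous_mpolyP[_ homK2] : homogeneous_ideal G (ideal_pow K 2).
  by rewrite ideal_pow2 //; apply: homogeneous_idealM.
have HK2 : is_ideal (f2 @^-1` (f2 @` ideal_pow K 2)).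
  apply: is_ideal_preimage; apply: is_ideal_image => //; exact: is_ideal_pow.
have quadK q : q \is 2.-homog -> (f2 @` ideal_pow K 2) (f2 q).
  move=> hom_q; have : (f1 @` ideal_pow nS 2) (f1 q).
    exists q => //; rewrite ideal_pow_irrelevant.
    exact: order_ge_homog hom_q _.
  rewrite -eqK1 => -[y Ky f1yq].
  have /(ker1_homog 2) : f1 (q - y) = 0 by rewrite rmorphB f1yq subrr.
  move/(ker12 (pihomogP _ _ _)).
  rewrite raddfB /= rmorphB (pihomog_dE hom_q) => /subr0_eq ->.
  by exists (pi 2 y) => //; apply: homK2.
(* A monomial of degree at least 2 is a multiple of a product of two variables, found by splitting
   off a variable twice. *)
apply: (order_ge_monomials HK2 _ p2) => m lt1m.
have [i def_m] := monomial_split (ltnW lt1m).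
have [j ->] : exists j : 'I_n, m = ((m - U_(i) - U_(j)) + (U_(i) + U_(j)))%MM.
  have [j def_m'] : exists j : 'I_n,
      (m - U_(i) = U_(j) + (m - U_(i) - U_(j)))%MM.
    by apply: monomial_split; move: lt1m; rewrite {1}def_m mdegD mdeg1.
  by exists j; rewrite {1}def_m {1}def_m' addmA addmC.
rewrite mpolyXD; case: HK2 => _ _; apply.
by apply: quadK; rewrite dhomogX /= mdegD !mdeg1.
Qed.

End SameQuadraticPart.

(** * Correspondence between the ideals competing in cs or ms over the two quotients *)

Section SameQuadraticPartMin.
Variables (k : comNzRingType) (n : nat) (Q1 Q2 : comNzRingType).
Local Notation S := {mpoly k[n]}.
Local Notation G := (mpoly_grading k n).
Local Notation nS := (irrelevant_ideal G).
Local Notation pi d := (pihomog mdeg d).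
Variables (f1 : {rmorphism S -> Q1}) (f2 : {rmorphism S -> Q2}).
Local Notation G1 := (fun i => f1 @` G i).
Local Notation G2 := (fun i => f2 @` G i).

Hypothesis f1_surj : forall y, exists x, f1 x = y.
Hypothesis f2_surj : forall y, exists x, f2 x = y.
Hypothesis ker1_ge2 : forall p, f1 p = 0 -> order_ge 2 p.
Hypothesis ker2_ge2 : forall p, f2 p = 0 -> order_ge 2 p.
Hypothesis ker1_homog : forall p d, f1 p = 0 -> f1 (pi d p) = 0.
Hypothesis ker2_homog : forall p d, f2 p = 0 -> f2 (pi d p) = 0.
Hypothesis ker12 : forall p, p \is 2.-homog -> f1 p = 0 <-> f2 p = 0.

Let is_ideal_nS := is_ideal_irrelevant_mpoly k n.

(** Both hypotheses say that N^3 is contained in NK modulo the kernel. Then NK plus either kernel is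
    the same ideal of S, which is what [is_mu_image] requires. *)
Lemma is_mu_same_quadratic (K : set S) d :
  (forall p, order_ge 3 p -> (f1 @` idealM nS K) (f1 p)) ->
  (forall p, order_ge 3 p -> (f2 @` idealM nS K) (f2 p)) ->
  is_mu (irrelevant_ideal G1) (f1 @` K) d <->
  is_mu (irrelevant_ideal G2) (f2 @` K) d.
Proof.
move=> nK1 nK2; rewrite -!image_irrelevant_ideal.
have ge1 p : order_ge 2 p -> nS p.
  by rewrite irrelevant_mpolyE; apply: order_geS.
have nK12 x : (f1 @` idealM nS K) (f1 x) <-> (f2 @` idealM nS K) (f2 x).
  split; apply: mod_idealM_transfer => // p hom_p; last by move/ker12; apply.
  by apply: (ker12 _).1.
split; apply: is_mu_image => // x; last by rewrite nK12.
  by move/ker1_ge2/ge1.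
by move/ker2_ge2/ge1.
Qed.

Lemma cs_ideal_transfer (J : set Q1) : cs_ideal G1 J ->
  exists2 J', cs_ideal G2 J' & forall d,
    is_mu (irrelevant_ideal G1) J d <-> is_mu (irrelevant_ideal G2) J' d.
Proof.
move=> [homJ Jn J2]; pose K := f1 @^-1` J.
have homK : homogeneous_ideal G K by exact: homogeneous_preimage homJ.
have Kn : K `<=` nS by exact: sub_preimage_nS Jn.
have fK : f1 @` K = J by exact: image_preimage_surj.
have K2_1 : f1 @` ideal_pow K 2 = f1 @` ideal_pow nS 2.
  by rewrite !image_ideal_pow // fK image_irrelevant_ideal.
have K2_2 : f2 @` ideal_pow K 2 = f2 @` ideal_pow nS 2.
  by apply: square_transfer K2_1 => // p hom_p; apply: (ker12 _).1.
(* Modulo the kernel of [f], N^3 = N N^2 = N K^2, and K^2 is contained in K. *)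
have nK (Q : comNzRingType) (f : {rmorphism S -> Q}) :
    (forall y, exists x, f x = y) -> f @` ideal_pow K 2 = f @` ideal_pow nS 2 ->
    forall p, order_ge 3 p -> (f @` idealM nS K) (f p).
  move=> f_surj eqK p p3.
  suff : (f @` idealM nS (ideal_pow K 2)) (f p).
    apply: image_subset; apply: idealMS => //.
    by case: homK => HK _; rewrite ideal_pow2 //; apply: idealM_subr.
  rewrite image_idealM // eqK -image_idealM //; exists p => //.
  by move: p3; rewrite -ideal_pow_irrelevant.
exists (f2 @` K).
  2: by move=> d; rewrite -fK; apply: is_mu_same_quadratic; apply: nK.
split; first exact: homogeneous_image.
- by rewrite -image_irrelevant_ideal; apply: image_subset.
- by rewrite -image_irrelevant_ideal -!image_ideal_pow.
Qed.

Lemma ms_ideal_transfer (J : set Q1) : ms_ideal G1 J ->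
  exists2 J', ms_ideal G2 J' & forall d,
    is_mu (irrelevant_ideal G1) J d <-> is_mu (irrelevant_ideal G2) J' d.
Proof.
move=> [homJ Jn J2]; pose K := f1 @^-1` J.
have homK : homogeneous_ideal G K by exact: homogeneous_preimage homJ.
have Kn : K `<=` nS by exact: sub_preimage_nS Jn.
have fK : f1 @` K = J by exact: image_preimage_surj.
have K2 : ideal_pow nS 2 `<=` K.
  move=> p p2; apply: J2; rewrite -image_irrelevant_ideal -image_ideal_pow //.
  by exists p.
(* Here N^2 is contained in K already in S, so N^3 is contained in NK before passing to any
   quotient. *)
have nK (Q : comNzRingType) (f : {rmorphism S -> Q}) p :
    order_ge 3 p -> (f @` idealM nS K) (f p).
  rewrite -ideal_pow_irrelevant => p3; exists p => //.
  by move: p3; apply: idealMS.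
exists (f2 @` K).
  2: by move=> d; rewrite -fK; apply: is_mu_same_quadratic; apply: nK.
split; first exact: homogeneous_image.
- by rewrite -image_irrelevant_ideal; apply: image_subset.
- by rewrite -image_irrelevant_ideal -image_ideal_pow //; apply: image_subset.
Qed.

End SameQuadraticPartMin.

(** * Quotients by a proper ideal *)

Lemma pi_quot_eq (A : comNzRingType) (I : idealr A) (x y : A) :
  \pi_{ideal_quot I} x = \pi_{ideal_quot I} y <-> x - y \in I.
Proof. by rewrite Quotient.idealrBE; split=> /eqP. Qed.

Lemma pi_quot_eq0 (A : comNzRingType) (I : idealr A) (x : A) :
  \pi_{ideal_quot I} x = 0 <-> x \in I.
Proof. by have := pi_quot_eq I x 0; rewrite subr0 rmorph0. Qed.

Lemma pi_quot_surj (A : comNzRingType) (I : idealr A) (y : {ideal_quot I}) :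
  exists x, \pi_{ideal_quot I} x = y.
Proof. by exists (repr y); rewrite reprK. Qed.

Lemma idealr_is_ideal (A : comNzRingType) (I : idealr A) : is_ideal [set` I].
Proof.
split=> [|x y|a x] /=; [exact: rpred0|exact: rpredD|exact: idealMr].
Qed.

(** * Degrees zero and one of the associated graded ring *)

Section AssocGr.
Variables (R : comNzRingType) (m : idealr R).
Local Notation k := {ideal_quot m}.
Local Notation gr := (assoc_gr m).
Local Notation mpow := (ideal_pow [set` m]).

Lemma mpow1 : mpow 1 = [set` m].
Proof. exact/ideal_pow1/idealr_is_ideal. Qed.

Lemma mpow2 : mpow 2 = idealM [set` m] [set` m].
Proof. exact/ideal_pow2/idealr_is_ideal. Qed.

Lemma assoc_gr_const_eq0 (c : k) : assoc_gr_const m c = 0 -> c = 0.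
Proof.
move=> /pi_quot_eq0/asboolP/(_ 0); rewrite coefC mpow1 => mc.
by rewrite -[c]reprK; apply/pi_quot_eq0.
Qed.

Lemma rees_deg1_subproof (r : R) : r \in m -> r *: 'X \in rees_pred m.
Proof.
move=> mr; apply/rees_predP=> i; rewrite coefZ coefX.
have [->|_] := eqVneq i 1%N; first by rewrite mulr1 mpow1.
by rewrite mulr0; case: (is_ideal_pow [set` m] i).
Qed.

(** The class of r in m/m^2, represented in the Rees algebra by the monomial rX. *)
Definition assoc_gr_deg1 (r : R) (mr : r \in m) : gr :=
  \pi_{ideal_quot (@rees_ideal R m)} (Rees (rees_deg1_subproof mr)).

Lemma assoc_gr_deg1_grading r (mr : r \in m) :
  assoc_gr_grading m 1 (assoc_gr_deg1 mr).
Proof.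
exists (Rees (rees_deg1_subproof mr)) => // j /eqP/negPf ne.
by rewrite coefZ coefX ne mulr0.
Qed.

Lemma assoc_gr_grading1 (x : gr) : assoc_gr_grading m 1 x ->
  exists r (mr : r \in m), x = assoc_gr_deg1 mr.
Proof.
case=> p p0 ->; have mp : (val p)`_1 \in m.
  by have /rees_predP/(_ 1) := reesP p; rewrite mpow1.
exists (val p)`_1, mp; rewrite /assoc_gr_deg1; congr (\pi _).
apply/val_inj/polyP => i.
rewrite coefZ coefX; have [->|ne] := eqVneq i 1%N; first by rewrite mulr1.
by rewrite mulr0; apply/p0/eqP.
Qed.

(** The difference of the two sides is represented by a multiple of X in the Rees algebra, and it is
    zero in gr exactly when its coefficient lies in m^2. *)
Lemma assoc_gr_deg1_comb n (v : 'I_n -> k) (b : 'I_n -> R)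
    (mb : forall i, b i \in m) r (mr : r \in m) :
  assoc_gr_deg1 mr = \sum_(i < n) assoc_gr_const m (v i) * assoc_gr_deg1 (mb i)
  <-> idealM [set` m] [set` m] (r - \sum_(i < n) repr (v i) * b i).
Proof.
pose s := \sum_(i < n) Rees (rees_const_subproof m (repr (v i))) *
                       Rees (rees_deg1_subproof (mb i)).
have -> : \sum_(i < n) assoc_gr_const m (v i) * assoc_gr_deg1 (mb i) =
    \pi_{ideal_quot (@rees_ideal R m)} s.
  by rewrite rmorph_sum; apply: eq_bigr => i _; rewrite rmorphM.
rewrite pi_quot_eq -mpow2.
have valE : val (Rees (rees_deg1_subproof mr) - s) =
    (r - \sum_(i < n) repr (v i) * b i) *: 'X :> {poly R}.
  rewrite scalerBl scaler_suml raddfB; congr (_ - _); rewrite raddf_sum.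
  by apply: eq_bigr => i _; rewrite -scalerA; apply: mul_polyC.
split=> [/asboolP/(_ 1)|Hr].
  by rewrite valE coefZ coefX mulr1.
apply/asboolP => i; rewrite valE coefZ coefX.
have [->|_] := eqVneq i 1%N; first by rewrite mulr1.
by rewrite mulr0; case: (is_ideal_pow [set` m] i.+1).
Qed.

End AssocGr.

(** * The presentation of gr has no relations of degree below two *)

Section Presentation.
Variables (R : comNzRingType) (m : idealr R) (n : nat).
Local Notation k := {ideal_quot m}.
Local Notation S := {mpoly k[n]}.
Local Notation G := (mpoly_grading k n).
Local Notation pi d := (pihomog mdeg d).
Variable I : idealr S.
Local Notation Q := {ideal_quot I}.
Hypothesis hn : is_mu [set` m] [set` m] n.
Hypothesis hI : homogeneous_ideal G [set` I].
Hypothesis hgr : graded_iso (assoc_gr_const m) (mpoly_quot_const I)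
  (assoc_gr_grading m) (mpoly_quot_grading I).

(* The n generators X_i of the degree 1 part of gr_m(R) are related to a basis
   of m / m^2 by an n x n matrix with a one-sided, hence two-sided, inverse. *)
Lemma presentation_deg1_free (c : 'I_n -> k) :
  \sum_(i < n) (c i)%:MP * 'X_i \in I -> forall i, c i = 0.
Proof.
have [f [f_bij f_const f_gr]] := hgr.
have [b [mb gen_b free_b]] := hn.
pose pQ : S -> Q := \pi_{ideal_quot I}.
(* The [x i] are the classes of the variables, the [y i] the images of a basis of m/m^2; both live
   in degree one of S/I. *)
pose x i := pQ 'X_i; pose y i := f (assoc_gr_deg1 (mb i)).
pose iQ (c : k) : Q := pQ c%:MP.
have iQ_sum N (F : 'I_N -> k) : iQ (\sum_i F i) = \sum_i iQ (F i).
  by rewrite /iQ /pQ !rmorph_sum.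
have iQ_M a d : iQ (a * d) = iQ a * iQ d by rewrite /iQ /pQ !rmorphM.
(* A relation among the [y i] pulls back along [f] to an expression of the class of 0, which puts
   the combination of the [b i] in m^2; independence of the [b i] then applies. *)
have y_free (v : 'I_n -> k) : \sum_i iQ (v i) * y i = 0 -> forall i, v i = 0.
  have m0 : 0 \in m by exact: rpred0.
  have deg1_0 : assoc_gr_deg1 m0 = 0.
    apply/pi_quot_eq0/asboolP => i; rewrite coefZ mul0r.
    by case: (is_ideal_pow [set` m] i.+1).
  move=> v0 i; rewrite -[v i]reprK; apply/pi_quot_eq0; move: i; apply: free_b.
  rewrite -[\sum_(i < n) _]opprK; apply: (@is_idealN _ (idealM _ _)).
    exact: is_idealM.
  rewrite -sub0r; apply/(assoc_gr_deg1_comb v mb m0).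
  rewrite deg1_0; apply: (bij_inj f_bij); rewrite rmorph0 rmorph_sum -[LHS]v0.
  by apply: eq_bigr => i _; rewrite rmorphM f_const.
have /choice[N x_y] i : exists N : 'I_n -> k, x i = \sum_j iQ (N j) * y j.
  have : mpoly_quot_grading I 1 (x i).
    by exists 'X_i => //; rewrite /mpoly_grading /= dhomogX /= mdeg1.
  rewrite -f_gr => -[_ /assoc_gr_grading1[r [mr ->]] <-].
  have [c' Hc'] := gen_b r mr.
  exists (fun j => \pi_{ideal_quot m} (c' j)).
  have /(congr1 f) -> : assoc_gr_deg1 mr = \sum_(j < n)
      assoc_gr_const m (\pi_{ideal_quot m} (c' j)) * assoc_gr_deg1 (mb j).
    apply/assoc_gr_deg1_comb.
    (* Replacing each [c' j] by the chosen representative of its class modulo m changes the sum by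
       an element of m^2. *)
    have -> : r - \sum_(j < n) repr (\pi_{ideal_quot m} (c' j)) * b j =
      (r - \sum_(j < n) c' j * b j) +
      \sum_(j < n) (c' j - repr (\pi_{ideal_quot m} (c' j))) * b j.
      rewrite (eq_bigr _ (fun j _ => mulrBl _ _ _)) sumrB.
      by rewrite addrA subrK.
    have HM := is_idealM [set` m] [set` m].
    have [_ HD _] := HM; apply: HD => //.
    apply: (@is_ideal_sum _ (idealM _ _)) => // j.
    apply: mem_idealM; last exact: mb.
    by apply/pi_quot_eq; rewrite reprK.
  by rewrite rmorph_sum; apply: eq_bigr => j _; rewrite rmorphM f_const.
have /choice[M y_x] i : exists M : 'I_n -> k, y i = \sum_j iQ (M j) * x j.
  have : mpoly_quot_grading I 1 (y i).
    rewrite -f_gr; exists (assoc_gr_deg1 (mb i)) => //.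
    exact: assoc_gr_deg1_grading.
  case=> p /homog1E -> <-; exists (fun j => p@_U_(j)).
  by rewrite rmorph_sum; apply: eq_bigr => j _; rewrite rmorphM.
pose mM := \matrix_(i, j) M i j; pose mN := \matrix_(i, j) N i j.
have comb_x (v : 'I_n -> k) : \sum_i iQ (v i) * x i =
    \sum_j iQ ((\row_i v i *m mN) 0 j) * y j.
  under eq_bigr do rewrite x_y mulr_sumr.
  rewrite exchange_big; apply: eq_bigr => j _; rewrite mxE iQ_sum mulr_suml.
  by apply: eq_bigr => i _; rewrite !mxE iQ_M mulrA.
(* Substituting the [x j] into the expression of [y i] gives [y i] in terms of the [y j];
   independence forces the coefficients to be those of the identity. *)
have MN1 : mM *m mN = 1%:M.
  apply/matrixP => i j; apply/eqP; rewrite -subr_eq0; apply/eqP.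
  move: j; apply: y_free.
  have iQB a d : iQ (a - d) = iQ a - iQ d by rewrite /iQ /pQ !rmorphB.
  under eq_bigr do rewrite iQB mulrBl.
  rewrite sumrB; apply/eqP; rewrite subr_eq0; apply/eqP.
  transitivity (y i).
    rewrite [RHS]y_x comb_x; apply: eq_bigr => j _; congr (iQ _ * _).
    by rewrite !mxE; apply: eq_bigr => l _; rewrite !mxE.
  rewrite (bigD1 i) //= big1 => [|j ne].
    by rewrite mxE eqxx /iQ /pQ !rmorph1 mul1r addr0.
  by rewrite mxE eq_sym (negPf ne) /iQ /pQ !rmorph0 mul0r.
(* A linear relation among the [x i] becomes one among the [y j] with coefficients c N, so c N = 0;
   multiplying by M on the right gives c = 0. *)
move=> cI; have cN0 : \row_i c i *m mN = 0.
  apply/rowP => j; rewrite [RHS]mxE; apply: (y_free (fun j => _ 0 j)).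
  rewrite -comb_x; transitivity (pQ (\sum_(i < n) (c i)%:MP * 'X_i)).
    2: exact/pi_quot_eq0.
  by rewrite /pQ rmorph_sum; apply: eq_bigr => i _; rewrite rmorphM.
move=> i; have : (\row_i c i *m mN *m mM) 0 i = c i.
  by rewrite -mulmxA (mulmx1C MN1) mulmx1 mxE.
by rewrite cN0 mul0mx mxE.
Qed.

(** The components of an element of I are in I. The linear one vanishes by [presentation_deg1_free],
    the constant one because k embeds in gr and the isomorphism respects the structure maps. *)
Lemma presentation_ge2 : [set` I] `<=` order_ge 2.
Proof.
have [_ homI] := (homogeneous_mpolyP _).1 hI.
move=> p Ip e; rewrite ltnS leq_eqVlt => /orP[/mdeg1P[i /eqP ->]|].
  have I1 := homI p 1%N Ip.
  have := @presentation_deg1_free (fun i => (pi 1 p)@_U_(i)).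
  rewrite -homog1E; last exact: pihomogP.
  by move/(_ I1 i); rewrite mcoeff_pihomog mdeg1.
rewrite ltnS leqn0 mdeg_eq0 => /eqP ->.
have [f [f_bij f_const _]] := hgr.
have I0 : (p@_0)%:MP \in I.
  have := homI p 0 Ip; congr (_ \in I); apply/mpolyP => e'.
  rewrite mcoeff_pihomog mcoeffC mdeg_eq0.
  by case: eqP => [->|_]; rewrite ?mulr1 ?mulr0.
apply: (@assoc_gr_const_eq0 R m); apply: (bij_inj f_bij).
by rewrite f_const rmorph0; apply/pi_quot_eq0.
Qed.

End Presentation.

(** * The ideal generated by the quadratic forms of I *)

Section QuadraticPart.
Variables (k : comNzRingType) (n : nat).
Local Notation S := {mpoly k[n]}.
Local Notation G := (mpoly_grading k n).
Variable I : idealr S.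

Lemma quadratic_partE :
  [set` quadratic_part I] = ideal_span [set q | q \in I /\ G 2 q].
Proof. by apply/seteqP; split=> p /= /asboolP. Qed.

Lemma quadratic_part_sub : [set` quadratic_part I] `<=` [set` I].
Proof.
rewrite quadratic_partE; apply: ideal_span_sub; first exact: idealr_is_ideal.
by move=> q [].
Qed.

Lemma homogeneous_quadratic_part : homogeneous_ideal G [set` quadratic_part I].
Proof.
rewrite quadratic_partE; apply: homogeneous_span => p d Xp.
have [Ip hom_p] := Xp; have [<-|ne] := eqVneq 2%N d.
  by rewrite pihomog_dE //; apply: sub_ideal_span.
rewrite (pihomog_ne0 ne hom_p).
by case: (is_ideal_span [set q | q \in I /\ G 2 q]).
Qed.

Lemma quadratic_part_homog2 p : p \is 2.-homog ->
  (p \in quadratic_part I) = (p \in I).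
Proof.
move=> hom_p; apply/idP/idP => [|Ip]; first exact: quadratic_part_sub.
by apply/asboolP; apply: sub_ideal_span.
Qed.

End QuadraticPart.

(** * Equality of cs and ms for S/I and S/I_2 *)

(** The kernels of the two projections meet the transfer conditions in both directions. Equality of
    minima is expressed by a common value, so existence must be shown as well: the irrelevant ideal
    of S/I competes in both minima and has finite mu. *)
Lemma min_mu_quadratic_part (k : comNzRingType) (n : nat)
    (I : idealr {mpoly k[n]})
    (hI : homogeneous_ideal (mpoly_grading k n) [set` I])
    (I_ge2 : [set` I] `<=` order_ge 2) :
  (exists c : nat, is_cs (mpoly_quot_grading I) c /\
                   is_cs (mpoly_quot_grading (quadratic_part I)) c) /\
  (exists c : nat, is_ms (mpoly_quot_grading I) c /\
                   is_ms (mpoly_quot_grading (quadratic_part I)) c).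
Proof.
pose G := mpoly_grading k n; pose nS := irrelevant_ideal G.
have HnS : is_ideal nS by exact: is_ideal_irrelevant_mpoly.
pose f1 : {rmorphism {mpoly k[n]} -> _} := \pi_{ideal_quot I}.
pose f2 : {rmorphism {mpoly k[n]} -> _} := \pi_{ideal_quot (quadratic_part I)}.
have f1_surj : forall y, exists x, f1 x = y := @pi_quot_surj _ _.
have f2_surj : forall y, exists x, f2 x = y := @pi_quot_surj _ _.
have ker1_ge2 p : f1 p = 0 -> order_ge 2 p by move/pi_quot_eq0; apply: I_ge2.
have ker2_ge2 p : f2 p = 0 -> order_ge 2 p.
  by move/pi_quot_eq0/quadratic_part_sub; apply: I_ge2.
have ker_homog (J : idealr {mpoly k[n]}) : homogeneous_ideal G [set` J] ->
    forall p d, \pi_{ideal_quot J} p = 0 ->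
    \pi_{ideal_quot J} (pihomog mdeg d p) = 0.
  move=> /homogeneous_mpolyP[_ homJ] p d /pi_quot_eq0 Jp.
  by apply/pi_quot_eq0; apply: homJ.
have ker1_homog := ker_homog _ hI.
have ker2_homog := ker_homog _ (homogeneous_quadratic_part I).
have ker12 p : p \is 2.-homog -> f1 p = 0 <-> f2 p = 0.
  by move=> hom_p; rewrite !pi_quot_eq0 quadratic_part_homog2.
have ker21 p : p \is 2.-homog -> f2 p = 0 <-> f1 p = 0.
  by move=> hom_p; apply: iff_sym; apply: ker12.
pose n1 := irrelevant_ideal (mpoly_quot_grading I).
have n1E : f1 @` nS = n1 by exact: image_irrelevant_ideal.
have homn : homogeneous_ideal (mpoly_quot_grading I) n1.
  rewrite -n1E; apply: homogeneous_image => //; apply/homogeneous_mpolyP.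
  split=> // p d; rewrite /nS irrelevant_mpolyE => p0 m m0.
  by rewrite mcoeff_pihomog p0 // if_same.
have n1_sq : ideal_pow n1 2 `<=` n1.
  have Hn1 : is_ideal n1 by rewrite -n1E; apply: is_ideal_image.
  by rewrite ideal_pow2 //; apply: idealM_subr.
(* The basis of N/N^2 is carried from S to S/I by viewing S as its own quotient under the identity;
   membership in N^2 is the same on both sides because I is contained in N^2. *)
have mun : is_mu n1 n1 n.
  rewrite -n1E; move: (is_mu_irrelevant_mpoly k n); rewrite -/nS.
  have id_surj (y : {mpoly k[n]}) : exists x, idfun x = y by exists y.
  rewrite -[X in is_mu X X](image_id nS).
  apply: (is_mu_image (f1 := idfun) id_surj f1_surj) => //.
    by move=> x /= ->; case: HnS.
  move=> x; rewrite -(ideal_pow2 HnS) ideal_pow_irrelevant image_id.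
  split=> [x2|]; first by exists x.
  by apply: image_ideal_ker => //; apply: is_ideal_order_ge.
split.
- have [c csc] : exists c, is_cs (mpoly_quot_grading I) c.
    by apply: is_min_mu_exists mun; split.
  exists c; split=> //; apply: is_min_mu_transfer csc => J.
    exact: (cs_ideal_transfer (f1 := f1) (f2 := f2)).
  exact: (cs_ideal_transfer (f1 := f2) (f2 := f1)).
- have [c msc] : exists c, is_ms (mpoly_quot_grading I) c.
    by apply: is_min_mu_exists mun; split.
  exists c; split=> //; apply: is_min_mu_transfer msc => J.
    exact: (ms_ideal_transfer (f1 := f1) (f2 := f2)).
  exact: (ms_ideal_transfer (f1 := f2) (f2 := f1)).
Qed.

Theorem proposition4p12 (R : comNzRingType) (m : idealr R)
    (hR : noetherian_local_or_graded [set` m])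
    (n : nat) (hn : is_mu [set` m] [set` m] n)
    (I : idealr {mpoly {ideal_quot m}[n]})
    (hI : homogeneous_ideal (mpoly_grading {ideal_quot m} n) [set` I])
    (hgr : graded_iso (assoc_gr_const m) (mpoly_quot_const I)
             (assoc_gr_grading m) (mpoly_quot_grading I)) :
  (exists c : nat, is_cs (mpoly_quot_grading I) c /\
                   is_cs (mpoly_quot_grading (quadratic_part I)) c) /\
  (exists c : nat, is_ms (mpoly_quot_grading I) c /\
                   is_ms (mpoly_quot_grading (quadratic_part I)) c).
Proof.
by apply: min_mu_quadratic_part => //; apply: presentation_ge2 hn hI hgr.
Qed.
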